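(* Let $Q$ be the finite poset and $\mathbf{L}$ the finite lattice defined in the context. Then, although $\mathbf{L}$ embeds into $\mathbf{Co}(Q)$, there is no finite, tree-like poset $R$ such that $\mathbf{L}$ embeds (as a lattice) into $\mathbf{Co}(R)$.
   Context: For a poset $\langle P,\trianglelefteq\rangle$, a subset $X\subseteq P$ is order-convex if $x\trianglelefteq z\trianglelefteq y$ and $x,y\in X$ imply $z\in X$, for all $x,y,z\in P$. $\mathbf{Co}(P)$ denotes the lattice of all order-convex subsets of $P$, ordered by inclusion. Let $\prec$ be the predecessor (covering) relation of a poset $\langle P,\trianglelefteq\rangle$. A path of $P$ is a finite sequence $\langle x_0,\dots,x_{n-1}\rangle$ of distinct elements of $P$ such that either $x_i\prec x_{i+1}$ or $x_{i+1}\prec x_i$ for all $0\leq i\leq n-2$; if $n>0$, it is a path from $x_0$ to $x_{n-1}$. The poset $P$ is tree-like if (1) for all $a\trianglelefteq b$ in $P$ there are $n<\omega$ and $x_0,\dots,x_n\in P$ with $a=x_0\prec x_1\prec\cdots\prec x_n=b$; and (2) for all $a,b\in P$ there exists at most one path from $a$ to $b$. $Q$ is the $12$-element poset with elements $a_i,a'_i,b_i,b'_i,c_i,c'_i$ ($i\in\{0,1\}$) whose order is the reflexive and transitive closure of the relations $$x'_1\triangleleft x_1,\qquad x_0\triangleleft x'_0\quad\text{for } x\in\{a,b,c\},\qquad\text{and}\qquad x_1\triangleleft y_0\quad\text{for distinct } x,y\in\{a,b,c\}.$$ Let $\sigma$ be the anti-automorphism of $Q$ that exchanges the indices: $\sigma(x_i)=x_{1-i}$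 and $\sigma(x'_i)=x'_{1-i}$ for $x\in\{a,b,c\}$ and $i<2$. Then $\mathbf{L}$ is the set of all $X\in\mathbf{Co}(Q)$ such that $\sigma X=X$; it is a sublattice of $\mathbf{Co}(Q)$. *)

(* Defs.v *)
From HB Require Import structures.
From mathcomp Require Import all_boot all_order.

Set Implicit Arguments.
Unset Strict Implicit.
Unset Printing Implicit Defensive.

Import Order.TTheory.

Local Open Scope order_scope.

Definition order_convex d (P : finPOrderType d) (X : {set P}) : bool :=
  [forall x in X, forall y in X, forall z, (x <= z <= y) ==> (z \in X)].

Lemma order_convexP d (P : finPOrderType d) (X : {set P}) :
  reflect (forall x y z, x \in X -> y \in X -> x <= z <= y -> z \in X)
          (order_convex X).
Proof.
apply: (iffP forall_inP) => [cX x y z xX yX xzy|cX x xX].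
  by have /forall_inP/(_ y yX)/forallP/(_ z)/implyP := cX x xX; apply.
by apply/forall_inP => y yX; apply/forallP => z; apply/implyP; apply: cX xX yX.
Qed.

Record Co d (P : finPOrderType d) := MkCo {
  co_set :> {set P};
  co_convex : order_convex co_set }.

Fact co_display : Order.disp_t -> Order.disp_t. Proof. by []. Qed.

Section CoLattice.
Context d (P : finPOrderType d).
Implicit Types (X Y : {set P}) (A B C : Co P).

HB.instance Definition _ := [isSub for @co_set d P].
HB.instance Definition _ := [Finite of Co P by <:].

Definition co_le A B : bool := (A : {set P}) \subset B.

Fact co_le_refl : reflexive co_le.
Proof. by move=> A; apply: subxx. Qed.

Fact co_le_anti : antisymmetric co_le.
Proof. by move=> A B AB; apply/val_inj/eqP; rewrite eqEsubset. Qed.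

Fact co_le_trans : transitive co_le.
Proof. by move=> B A C; apply: subset_trans. Qed.

HB.instance Definition _ :=
  Order.Le_isPOrder.Build (co_display d) (Co P)
    co_le_refl co_le_anti co_le_trans.

Definition convex_hull X : {set P} :=
  [set z | [exists x in X, exists y in X, x <= z <= y]].

Lemma convex_hullP X z :
  reflect (exists x y, [/\ x \in X, y \in X & x <= z <= y])
          (z \in convex_hull X).
Proof.
rewrite inE; apply: (iffP exists_inP) => [[x xX /exists_inP[y yX xzy]]|].
  by exists x, y.
by move=> [x [y [xX yX xzy]]]; exists x => //; apply/exists_inP; exists y.
Qed.

Fact convex_hull_convex X : order_convex (convex_hull X).
Proof.
apply/order_convexP => x y z /convex_hullP[x1 [x2 [x1X _ /andP[x1x _]]]].
move=> /convex_hullP[y1 [y2 [_ y2X /andP[_ yy2]]]] /andP[xz zy].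
by apply/convex_hullP; exists x1, y2; rewrite (le_trans x1x xz) (le_trans zy).
Qed.

Lemma mem_between A x y z :
  x \in (A : {set P}) -> y \in (A : {set P}) -> x <= z <= y ->
  z \in (A : {set P}).
Proof. by have cA := elimT (order_convexP A) (co_convex A); apply: cA. Qed.

Fact setI_convex A B : order_convex (A :&: B).
Proof.
apply/order_convexP => x y z /setIP[xA xB] /setIP[yA yB] xzy.
apply/setIP; split; first exact: mem_between xA yA xzy.
exact: mem_between xB yB xzy.
Qed.

Definition co_meet A B : Co P := MkCo (setI_convex A B).
Definition co_join A B : Co P := MkCo (convex_hull_convex (A :|: B)).

Fact co_meetP A B C : (A <= co_meet B C) = (A <= B) && (A <= C).
Proof. exact: subsetI. Qed.

Fact co_joinP A B C : (co_join A B <= C) = (A <= C) && (B <= C).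
Proof.
rewrite -[RHS]/((A \subset C) && (B \subset C)) -subUset.
apply/idP/idP => [/subsetP hC|/subsetP sC]; apply/subsetP => z.
  by move=> zAB; apply: hC; apply/convex_hullP; exists z, z; rewrite lexx.
move=> /convex_hullP[x [y [/sC xC /sC yC xzy]]].
exact: mem_between xC yC xzy.
Qed.

HB.instance Definition _ :=
  Order.POrder_MeetJoin_isLattice.Build (co_display d) (Co P)
    co_meetP co_joinP.

End CoLattice.

Definition lattice_embeds d (K : latticeType d) d' (M : latticeType d') : Prop :=
  exists f : K -> M,
    [/\ injective f, Order.meet_morphism f & Order.join_morphism f].

Definition covers d (P : finPOrderType d) (x y : P) : bool :=
  (x < y) && [forall z, ~~ (x < z < y)].

Definition poset_path d (P : finPOrderType d) (s : seq P) : bool :=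
  uniq s && sorted (fun x y => covers x y || covers y x) s.

Definition path_from_to d (P : finPOrderType d) (a b : P) (s : seq P) : bool :=
  if s is x :: t then [&& poset_path s, x == a & last x t == b] else false.

Definition tree_like d (P : finPOrderType d) : Prop :=
  (forall a b : P, a <= b ->
     exists s, path (@covers d P) a s /\ last a s = b) /\
  (forall (a b : P) (s t : seq P),
     path_from_to a b s -> path_from_to a b t -> s = t).

(* The letters a, b, c are the elements of 'I_3, and the indices 0, 1 are     *)
(* false, true: [Base x i] is x_i and [Prime x i] is x'_i.                    *)
Variant Q := Base of 'I_3 & bool | Prime of 'I_3 & bool.

Definition Q_code (u : Q) : ('I_3 * bool) + ('I_3 * bool) :=
  match u with Base x i => inl (x, i) | Prime x i => inr (x, i) end.
Definition Q_decode (c : ('I_3 * bool) + ('I_3 * bool)) : Q :=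
  match c with inl p => Base p.1 p.2 | inr p => Prime p.1 p.2 end.
Fact Q_codeK : cancel Q_code Q_decode. Proof. by case. Qed.

HB.instance Definition _ := Finite.copy Q (can_type Q_codeK).

Definition Q_rel (u v : Q) : bool :=
  match u, v with
  | Prime x true, Base y true => x == y
  | Base x false, Prime y false => x == y
  | Base x true, Base y false => x != y
  | _, _ => false
  end.

Definition Q_le : rel Q := connect Q_rel.

Definition Q_height (u : Q) : nat :=
  match u with
  | Prime _ true => 0 | Base _ true => 1 | Base _ false => 2 | Prime _ false => 3
  end.

Fact Q_le_height u v : Q_le u v -> (u == v) || (Q_height u < Q_height v)%N.
Proof.
move=> /connectP[p]; elim: p u => [|w p IHp] u /=; first by move=> _ ->; rewrite eqxx.
case/andP=> uw /IHp/[apply] wv; apply/orP; right.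
have huw : (Q_height u < Q_height w)%N by case: u w uw {wv} => [x []|x []] [y []|y []].
by case/orP: wv => [/eqP <-|]; last exact: ltn_trans.
Qed.

Fact Q_le_refl : reflexive Q_le.
Proof. exact: connect0. Qed.

Fact Q_le_anti : antisymmetric Q_le.
Proof.
move=> u v /andP[/Q_le_height/predU1P[//|uv] /Q_le_height/predU1P[//|vu]].
by have := ltn_trans uv vu; rewrite ltnn.
Qed.

Fact Q_le_trans : transitive Q_le.
Proof. exact: connect_trans. Qed.

Fact Q_display : Order.disp_t. Proof. exact: Order.Disp tt tt. Qed.

HB.instance Definition _ :=
  Order.Le_isPOrder.Build Q_display Q Q_le_refl Q_le_anti Q_le_trans.

Definition sigma (u : Q) : Q :=
  match u with Base x i => Base x (~~ i) | Prime x i => Prime x (~~ i) end.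

Fact sigmaK : involutive sigma.
Proof. by case=> x []. Qed.

Fact sigma_le u v : (sigma u <= sigma v) = (v <= u).
Proof.
suff le_sigma u' v' : v' <= u' -> sigma u' <= sigma v'.
  by apply/idP/idP => /le_sigma; rewrite ?sigmaK.
move=> /connectP[p]; elim: p v' => [|w p IHp] t /=; first by move=> _ ->.
case/andP=> tw /IHp/[apply] /le_trans; apply; apply: connect1.
by case: t w tw => [x []|x []] [y []|y []] //=; rewrite eq_sym.
Qed.

Definition sigma_inv : {pred Co Q} := [pred X : Co Q | sigma @: X == X].

Fact sigma_invP (X : Co Q) :
  reflect (forall u, (sigma u \in X) = (u \in X)) (X \in sigma_inv).
Proof.
apply: (iffP eqP) => [sX u|sX].
  by rewrite -{1}[co_set X]sX mem_imset//; apply: inv_inj sigmaK.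
by apply/setP => u; rewrite -{1}[u]sigmaK mem_imset ?sX//; apply: inv_inj sigmaK.
Qed.

Fact sigma_inv_meet : {in sigma_inv &, forall X Y, X `&` Y \in sigma_inv}.
Proof.
by move=> X Y /sigma_invP sX /sigma_invP sY; apply/sigma_invP => u; rewrite !inE sX sY.
Qed.

Fact sigma_inv_join : {in sigma_inv &, forall X Y, X `|` Y \in sigma_inv}.
Proof.
move=> X Y /sigma_invP sX /sigma_invP sY.
have hullS u : u \in X `|` Y -> sigma u \in X `|` Y.
  move=> /convex_hullP[x [y [xXY yXY /andP[xu uy]]]].
  apply/convex_hullP; exists (sigma y), (sigma x).
  by move: xXY yXY; rewrite !inE !sX !sY !sigma_le xu uy.
apply/sigma_invP => u; apply/idP/idP => /hullS //.
by rewrite sigmaK.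
Qed.

Definition L := {X : Co Q | X \in sigma_inv}.

Fact L_display : Order.disp_t. Proof. exact: Order.Disp tt tt. Qed.

HB.instance Definition _ := Choice.on L.
HB.instance Definition _ := SubChoice.on L.
HB.instance Definition _ :=
  Order.SubChoice_isSubLattice.Build (co_display Q_display) (Co Q)
    (fun X => X \in sigma_inv) L_display L sigma_inv_meet sigma_inv_join.

(* Main.v *)
(* Write X, X' (for x = a, b, c) for the atoms {x_0, x_1}, {x'_0, x'_1} of L. *)
(* In L one has X <= X' \/ Y and Y /\ (X' \/ Z) = 0 for distinct x, y, z.     *)
(* Given an embedding f of L into Co(R), call a point of f(X) outside f(0) up *)
(* if some point of f(X') lies below it, down if some point of f(X') lies     *)
(* above it. The two relations force every up point of f(X) to lie below a    *)
(* down point of f(Y), for each y <> x, and dually; while no up point of f(X) *)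
(* lies below a down point of f(X). Hence R contains an infinite zigzag       *)
(* p_0 < p_1 > p_2 < ... through the letters a, b, c, a, b, c, ... When R is  *)
(* tree-like, successive legs of the zigzag may share an initial piece, but   *)
(* as p_n and p_(n+3) have the same letter, cancelling these pieces leaves a  *)
(* walk without backtracking, which never repeats a vertex: R is infinite.    *)

Require Import Defs.
From mathcomp Require Import all_boot all_order.

Set Implicit Arguments.
Unset Strict Implicit.
Unset Printing Implicit Defensive.

Import Order.TTheory.

Local Open Scope order_scope.

(** The proof has two halves that meet in the notion [zigzag]. On the lattice side, [zigzag_ascends]
    and [ascends_exists] extract a nonempty zigzag from any embedding, using only a few relations
    between elements of the lattice. On the order side, [tree_like_zigzag_bound] turns a zigzag in a
    tree-like poset into paths of unbounded length, extended edge by edge by [poset_path_cons]. *)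

(** * Paths in tree-like posets *)

Lemma coversW d (P : finPOrderType d) (x y : P) : covers x y -> x <= y.
Proof. by case/andP=> /ltW. Qed.

Lemma covers_dual d (P : finPOrderType d) (x y : P) :
  covers (x : P^d) (y : P^d) = covers y x.
Proof.
rewrite /covers ltEdual; congr (_ && _).
by apply: eq_forallb => z; rewrite !ltEdual andbC.
Qed.

Lemma poset_path_dual d (P : finPOrderType d) (s : seq P) :
  poset_path (s : seq P^d) = poset_path s.
Proof.
rewrite /poset_path; congr (_ && _).
by case: s => //= x s; apply: eq_path => y z; rewrite !covers_dual orbC.
Qed.

Lemma path_covers_le d (P : finPOrderType d) (x : P) s :
  path (@covers d P) x s -> {in s, forall y, x < y <= last x s}.
Proof.
elim: s x => //= y s IHs x /andP[xy ys] z.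
have lt_xy : x < y by case/andP: xy.
have le_y : y <= last y s.
  case: s ys IHs => //= w s yws IHs.
  by have /andP[/ltW yw /(le_trans yw)] := IHs y yws w (mem_head _ _).
rewrite inE => /predU1P[->|zs]; first by rewrite lt_xy.
by have /andP[/(lt_trans lt_xy) ->] := IHs y ys z zs.
Qed.

Lemma tree_like_dual d (P : finPOrderType d) : tree_like P -> tree_like P^d.
Proof.
case=> chains paths; split=> [a b | a b s t].
  rewrite leEdual => /chains[s [bs lastb]].
  exists (rev (belast b s)); rewrite -lastb; split.
    rewrite rev_path (eq_path (e' := @covers d P)) // => x y.
    exact: covers_dual.
  by case: s {bs lastb} => //= c s; rewrite rev_cons last_rcons.
have dualE u : path_from_to (a : P^d) b u = path_from_to (a : P) b u.
  by case: u => //= x u; rewrite poset_path_dual.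
by rewrite !dualE; apply: paths.
Qed.

(** If [c] already lay on the path, its segment from [q] to [c] and the single edge from [q] to [c]
    would be two paths with the same ends. By uniqueness they agree, so [c] would be the vertex
    right after [q]. *)
Lemma poset_path_cons d (P : finPOrderType d) (c q : P) s :
  tree_like P -> covers q c -> poset_path (q :: s) -> c != head q s ->
  poset_path (c :: q :: s).
Proof.
case=> _ paths qc /andP[uqs qs] c_head.
have c_q : c != q by case/andP: qc => /lt_eqF; rewrite eq_sym => ->.
apply/andP; split; last by rewrite /= qc orbT.
rewrite cons_uniq uqs inE negb_or c_q andbT /=.
apply/negP=> cs; case/splitPr: s / cs uqs qs c_head => s1 s2.
rewrite -cat_rcons /= cat_uniq cat_path mem_cat negb_or.
case/andP=> /andP[q_s1 _] /andP[us1 _] /andP[qs1 _] c_head.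
have /(paths _ _ _ [:: q; c]) : path_from_to q c (q :: rcons s1 c).
  by rewrite /= /poset_path /= q_s1 us1 qs1 last_rcons !eqxx.
rewrite /= /poset_path /= inE eq_sym c_q qc !eqxx => /(_ isT)[def_s1].
by rewrite def_s1 /= eqxx in c_head.
Qed.

(* Climbing from [q] towards [last q t], stop at the first point above [r]:   *)
(* the vertex [y] before it is not above [r], so that descending to [r] from  *)
(* there does not backtrack.                                                  *)
Lemma poset_path_climb d (P : finPOrderType d) (r q : P) s t :
  tree_like P -> poset_path (q :: s) -> path (@covers d P) q t ->
  head q s \notin t -> ~~ (r <= q) -> r <= last q t ->
  exists q' y s', [/\ poset_path [:: q', y & s'], q <= q', q' <= last q t,
    r <= q' & ~~ (r <= y) /\ (size s <= size s')%N].
Proof.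
move=> treeP; elim: t q s => [|c t IHt] q s qs /=.
  by move=> _ _ /negbTE->.
case/andP=> qc ct; rewrite inE negb_or eq_sym => /andP[c_head _] rq r_last.
have ltc := path_covers_le ct.
have cqs := poset_path_cons treeP qc qs c_head.
have [rc|rc] := boolP (r <= c).
  exists c, q, s; split=> //; first exact: coversW.
  case: t ct ltc {IHt r_last} => //= w t _.
  by move=> /(_ w (mem_head _ _))/andP[/ltW cw]; apply: le_trans.
have q_t : head c (q :: s) \notin t.
  by apply/negP=> /ltc/andP[/lt_geF]; rewrite (coversW qc).
have [q' [y [s' [q's' cq' q'_last rq' [ry ss']]]]] :=
  IHt _ _ cqs ct q_t rc r_last.
exists q', y, s'; split=> //; first exact: le_trans (coversW qc) cq'.
by split=> //; apply: ltnW.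
Qed.

(** * Zigzags are impossible in finite tree-like posets *)

(* [U x] and [D x] stand for the up and down points of letter [x].            *)
Definition zigzag d (P : finPOrderType d) (I : eqType) (U D : I -> P -> Prop) :=
  [/\ forall x y p, x != y -> U x p -> exists2 q, D y q & p <= q,
      forall x y p, x != y -> D x p -> exists2 q, U y q & q <= p
    & forall x p q, U x p -> D x q -> ~~ (p <= q)].

Lemma zigzag_dual d (P : finPOrderType d) (I : eqType) (U D : I -> P -> Prop) :
  zigzag U D -> zigzag (P := P^d) D U.
Proof.
case=> UD DU notUD; split=> [x y p xy Dp|x y p xy Up|x p q Dp Uq].
- by have [q Uq qp] := DU x y p xy Dp; exists q.
- by have [q Dq pq] := UD x y p xy Up; exists q.
- exact: notUD Uq Dp.
Qed.

(* [px], [py], [pz] are consecutive points of the zigzag, and [q :: s] is the *)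
(* reduced path from the turning point [q] between [py] and [pz] back to the  *)
(* start. The next point [r] below [pz] has letter [x] again, so it is not    *)
(* below [q <= px]: the next turning point is strictly above [q] and the path *)
(* grows.                                                                     *)
Lemma tree_like_zigzag_bound n d (P : finPOrderType d) (I : eqType)
    (U D : I -> P -> Prop) x y z (px py pz q : P) s :
  tree_like P -> zigzag U D -> uniq [:: x; y; z] ->
  D x px -> q <= px -> U y py -> py <= q -> D z pz -> q <= pz ->
  poset_path (q :: s) -> (s != [::] -> ~~ (head q s <= pz)) ->
  (size s + n < #|P|)%N.
Proof.
elim: n => [|n IHn] in d P U D x y z px py pz q s *.
  move=> _ _ _ _ _ _ _ _ _ /andP[/card_uniqP cqs _] _.
  by rewrite addn0 -[(size s).+1]/(size (q :: s)) -cqs max_card.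
move=> treeP zig uxyz Dpx qpx Upy pyq Dpz qpz qs s_pz.
have uyzx : uniq [:: y; z; x] by rewrite -(rot_uniq 1) in uxyz.
have zx : z != x by move: uyzx; rewrite /= !inE => /and3P[].
have [UD DU notUD] := zig.
have [r Ur rpz] := DU z x pz zx Dpz.
have rq : ~~ (r <= q).
  by apply: contra (notUD _ _ _ Ur Dpx) => rq; apply: le_trans qpx.
have [t [qt last_t]] := treeP.1 q pz qpz.
(* Every vertex of [t] lies strictly above [q] and below [pz]. For empty [s] the default head is [q]
   itself, which is not strictly above [q]. *)
have s_t : head q s \notin t.
  have let_t := path_covers_le qt; rewrite last_t in let_t.
  apply/negP=> /let_t; case: s s_pz {qs} => [_|w s /(_ isT)/negbTE /= ->].
    by rewrite ltxx.
  by rewrite andbF.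
rewrite -last_t in rpz.
have [q' [y' [s' [q's' qq' q't rq' [ry' ss']]]]] :=
  poset_path_climb treeP qs qt s_t rq rpz.
rewrite last_t in q't.
have pyq' := le_trans pyq qq'.
(* The next leg of the zigzag goes down, so the induction continues in the dual poset with the
   letters rotated. *)
apply: leq_ltn_trans (IHn _ P^d D U y z x py pz r q' (y' :: s')
  (tree_like_dual treeP) (zigzag_dual zig) uyzx Upy pyq' Dpz q't Ur rq' _ _).
- by rewrite addnS -addSn /= leq_add2r.
- by rewrite poset_path_dual.
- by [].
Qed.

Lemma tree_like_no_zigzag d (P : finPOrderType d) (I : eqType)
    (U D : I -> P -> Prop) x y z p :
  tree_like P -> zigzag U D -> uniq [:: x; y; z] -> ~ U x p.
Proof.
move=> treeP zig; rewrite /= !inE negb_or => /and3P[/andP[xy xz] yz _] Up.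
have [UD _ _] := zig.
have [qy Dqy pqy] := UD x y p xy Up; have [qz Dqz pqz] := UD x z p xz Up.
have uyxz : uniq [:: y; x; z] by rewrite /= !inE negb_or eq_sym xy yz xz.
have head_nil : ([::] : seq P) != [::] -> ~~ (head p [::] <= qz) by [].
(* Taking #|P| further turns from the one-point path at [p] gives the absurd bound #|P| < #|P|. *)
have := @tree_like_zigzag_bound #|P| _ P I U D y x z qy p qz p [::]
  treeP zig uyxz Dqy pqy Up (lexx p) Dqz pqz isT head_nil.
by rewrite add0n ltnn.
Qed.

(** * From lattice relations to a zigzag *)

Section JoinConfiguration.
Context dK (K : latticeType dK) (I : eqType) (zero : K) (A A' : I -> K).
Hypothesis meetAA' : forall x, A x `&` A' x = zero.
Hypothesis meetAA : forall x y, x != y -> A x `&` A y = zero.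
Hypothesis leA : forall x y, x != y -> A x <= A' x `|` A y.
Hypothesis meetAj :
  forall x y z, uniq [:: x; y; z] -> A y `&` (A' x `|` A z) = zero.
Hypothesis third : forall x y : I, x != y -> exists z, uniq [:: x; y; z].

Context d (R : finPOrderType d) (f : K -> Co R).
Hypothesis fI : Order.meet_morphism f.
Hypothesis fU : Order.join_morphism f.

(* With [r] the order of [R] or its converse, [ascends r x] defines the up or *)
(* the down points.                                                           *)
Definition ascends (r : rel R) x p :=
  [/\ p \in (f (A x) : {set R}), p \notin (f zero : {set R})
    & exists2 u, u \in (f (A' x) : {set R}) & r u p].

Let is_order (r : rel R) :=
  r =2 (fun x y => x <= y) \/ r =2 (fun x y => y <= x).

Lemma mem_morphI a b p : p \in f (a `&` b) = (p \in f a) && (p \in f b).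
Proof. by rewrite fI inE. Qed.

Lemma mem_morph_le a b p : a <= b -> p \in f a -> p \in f b.
Proof. by move=> /meet_idPl <-; rewrite mem_morphI => /andP[]. Qed.

Lemma mem_morphU r a b p : is_order r ->
  reflect (exists u v, [/\ u \in (f a : {set R}) :|: f b,
                           v \in (f a : {set R}) :|: f b, r u p & r p v])
          (p \in f (a `|` b)).
Proof.
rewrite fU => r_order; apply: (iffP (convex_hullP _ _)) => -[u [v]].
  case=> uX vX /andP[up pv].
  by case: r_order => rE; [exists u, v | exists v, u]; rewrite !rE.
case=> uX vX; case: r_order => rE; rewrite !rE => up pv.
  by exists u, v; rewrite up pv.
by exists v, u; rewrite up pv.
Qed.

Lemma mem_morph_between r a u v p : is_order r ->
  u \in f a -> v \in f a -> r u p -> r p v -> p \in f a.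
Proof.
move=> r_order ua va up pv; rewrite -(joinxx a).
apply/(mem_morphU _ _ _ r_order).
by exists u, v; rewrite setUid.
Qed.

(** Say [r] is the order. Since [A x] is below the join of [A' x] and [A y], some [v] of one of
    their images lies above [p]; it is not in [f (A' x)], or convexity would put [p] there too.
    Likewise some [w] in [f (A' y)] or [f (A z)] lies above [v]; the latter is excluded by [meetAj],
    as [v] would lie between [u] and [w]. *)
Lemma ascends_above r x y p : is_order r -> x != y -> ascends r x p ->
  exists2 q, ascends (fun u v => r v u) y q & r p q.
Proof.
move=> r_order xy [px p0 [u ux' up]].
have [v [vy v0 pv]] : exists v, [/\ v \in f (A y), v \notin f zero & r p v].
  have /(mem_morphU _ _ _ r_order)[_ [v [_ + _ pv]]] :=
    mem_morph_le (leA xy) px.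
  have nvx' : v \notin f (A' x).
    apply: contra p0 => vx'; rewrite -(meetAA' x) mem_morphI px.
    exact: mem_morph_between r_order ux' vx' up pv.
  rewrite inE (negbTE nvx') /= => vy; exists v; split=> //.
  by apply: contra nvx'; apply: mem_morph_le; rewrite -(meetAA' x) leIr.
exists v => //; split=> //.
have [z xyz] := third xy.
have yz : y != z by move: xyz; rewrite /= !inE => /and3P[].
have /(mem_morphU _ _ _ r_order)[_ [w [_ + _ vw]]] := mem_morph_le (leA yz) vy.
rewrite inE => /orP[wy'|wz]; first by exists w.
case/negP: v0; rewrite -(meetAj xyz) mem_morphI vy.
apply/(mem_morphU _ _ _ r_order); exists u, w; rewrite !inE ux' wz orbT.
split=> //.
by case: r_order up pv => rE; rewrite !rE => up pv;
  [apply: le_trans up pv | apply: le_trans pv up].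
Qed.

Lemma zigzag_ascends :
  zigzag (ascends (fun u v => u <= v)) (ascends (fun u v => v <= u)).
Proof.
split=> [x y p xy px|x y p xy px|x p q].
- by apply: ascends_above xy px; left.
- by apply: ascends_above xy px; right.
(* From [u <= p <= q <= v] with both ends in [f (A' x)], convexity puts [p] in [f (A' x)]. *)
case=> px p0 [u ux' up] [_ _ [v vx' qv]]; apply: contra p0 => pq.
rewrite -(meetAA' x) mem_morphI px /=.
by apply: mem_between ux' vx' _; rewrite up (le_trans pq).
Qed.

Lemma ascends_exists x y : injective f -> x != y -> A x != zero ->
  exists p, ascends (fun u v => u <= v) x p \/ ascends (fun u v => v <= u) x p.
Proof.
move=> f_inj xy Ax0.
have [p px p0] : exists2 p, p \in f (A x) & p \notin f zero.
  apply/subsetPn; apply: contra Ax0 => Ax_sub; apply/eqP/f_inj/le_anti.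
  apply/andP; split=> //; apply/subsetP => p; apply: mem_morph_le.
  by rewrite -(meetAA' x) leIl.
exists p.
have le_order : is_order (fun u v => u <= v) by left.
have /(mem_morphU _ _ _ le_order)[u [v []]] := mem_morph_le (leA xy) px.
rewrite !inE => /orP[ux' _ up _|uy /orP[vx' _ pv|vy up pv]].
- by left; split=> //; exists u.
- by right; split=> //; exists v.
case/negP: p0; rewrite -(meetAA xy) mem_morphI px.
exact: mem_morph_between le_order uy vy up pv.
Qed.

End JoinConfiguration.

(** * The order of [Q] and the atoms of [L] *)

Definition Q_leb (u v : Q) : bool :=
  match u, v with
  | Prime x true, Prime y true | Prime x true, Base y true
  | Base x true, Base y true | Base x false, Base y false
  | Base x false, Prime y false | Prime x false, Prime y false => x == y
  | Prime x true, Base y false | Prime x true, Prime y false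
  | Base x true, Base y false | Base x true, Prime y false => x != y
  | _, _ => false
  end.

Lemma Q_leE (u v : Q) : (u <= v) = Q_leb u v.
Proof.
apply/idP/idP => [/connectP[p]|].
  elim: p u => [|w p IHp] u /=; first by move=> _ ->; case: u => x [] /=.
  case/andP=> uw /IHp/[apply] {IHp p}.
  by case: u uw => x []; case: w => y [] //; case: v => z [] //=;
    (move/eqP-> || move=> xy /eqP<-).
have rel_le u' v' : Q_rel u' v' -> u' <= v' by apply: connect1.
have lex x : Prime x true <= Base x true by apply: rel_le; rewrite /= eqxx.
have ley x : Base x false <= Prime x false by apply: rel_le; rewrite /= eqxx.
have lexy x y : x != y -> Base x true <= Base y false.
  by move=> xy; apply: rel_le.
case: u => x []; case: v => y [] //=; try by move/eqP->.
- exact: lexy.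
- by move/lexy => xy; apply: le_trans xy (ley y).
- by move/lexy => xy; apply: le_trans (lex x) xy.
- by move/lexy => xy; apply: le_trans (lex x) (le_trans xy (ley y)).
Qed.

(** The fibres are the orbits of [sigma], each a two-element antichain. *)
Definition Q_type (u : Q) : 'I_3 * bool :=
  match u with Base x _ => (x, false) | Prime x _ => (x, true) end.

Lemma Q_type_sigma u : Q_type (sigma u) = Q_type u.
Proof. by case: u. Qed.

Lemma Q_type_convex t : order_convex [set u | Q_type u == t].
Proof.
apply/order_convexP => u v w; rewrite !inE !Q_leE => /eqP<- /eqP.
by case: u => x []; case: v => y [] //= [->]; case: w => z [] //=;
  rewrite ?andbF ?andbT //;
  by [case/andP=> /eqP-> | rewrite eq_sym ?andNb ?andbN].
Qed.

Lemma Q_type_sigma_inv t : MkCo (Q_type_convex t) \in sigma_inv.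
Proof. by apply/sigma_invP => u; rewrite !inE Q_type_sigma. Qed.

Definition L_atom (t : 'I_3 * bool) : L :=
  exist (fun X : Co Q => X \in sigma_inv) _ (Q_type_sigma_inv t).

Lemma set0_convex d (P : finPOrderType d) : order_convex (set0 : {set P}).
Proof. by apply/order_convexP => x y z; rewrite inE. Qed.

Lemma set0_sigma_inv : MkCo (set0_convex Q) \in sigma_inv.
Proof. by apply/sigma_invP => u; rewrite !inE. Qed.

Definition L_bot : L :=
  exist (fun X : Co Q => X \in sigma_inv) _ set0_sigma_inv.

Lemma L_leP (X Y : L) :
  reflect {subset (val X : {set Q}) <= (val Y : {set Q})} (X <= Y).
Proof. exact: subsetP. Qed.

Lemma L_joinE (X Y : L) :
  (val (X `|` Y) : {set Q}) = convex_hull ((val X : {set Q}) :|: val Y).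
Proof. by []. Qed.

Lemma L_bot_le X : L_bot <= X.
Proof. by apply/L_leP => u; rewrite inE. Qed.

Lemma L_meet_bot (X Y : L) :
  (forall u, u \in (val X : {set Q}) -> u \in (val Y : {set Q}) -> False) ->
  X `&` Y = L_bot.
Proof.
move=> dXY; apply: le_anti; rewrite L_bot_le andbT.
by apply/L_leP => u /setIP[uX /(dXY u uX)].
Qed.

Lemma L_atom_meet s t : s != t -> L_atom s `&` L_atom t = L_bot.
Proof.
by move=> st; apply: L_meet_bot => u; rewrite !inE => /eqP-> /(negP st).
Qed.

Lemma L_atom_neq_bot x b : L_atom (x, b) != L_bot.
Proof.
apply/eqP=> t_bot.
have /setP/(_ (if b then Prime x b else Base x b)) :=
  congr1 (fun X : L => val X : {set Q}) t_bot.
by rewrite !inE; case: b {t_bot} => /=; rewrite eqxx.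
Qed.

(** x_1 lies between x'_1 and y_0, and x_0 between y_1 and x'_0. *)
Lemma L_atom_le_join x y : x != y ->
  L_atom (x, false) <= L_atom (x, true) `|` L_atom (y, false).
Proof.
move=> xy; apply/L_leP => u; rewrite L_joinE => u_x; apply/convex_hullP.
move: u_x; rewrite inE.
case: u => z [] //= /eqP[] // ->.
  exists (Prime x true), (Base y false).
  by rewrite !inE !Q_leE /= !eqxx orbT xy.
exists (Base y true), (Prime x false).
by rewrite !inE !Q_leE /= !eqxx orbT (eq_sym y) xy.
Qed.

(** Only y_1 and y'_1 lie below y_1, and only y_0 and y'_0 above y_0. *)
Lemma L_atom_meet_join x y z : uniq [:: x; y; z] ->
  L_atom (y, false) `&` (L_atom (x, true) `|` L_atom (z, false)) = L_bot.
Proof.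
rewrite /= !inE negb_or => /and3P[/andP[xy _] yz _].
apply: L_meet_bot => u; rewrite L_joinE => uy /convex_hullP[v [w []]].
rewrite !inE !Q_leE in uy *.
case: u uy => u [] //= /eqP[] // -> {u}.
- move=> v_xz _ /andP[+ _]; case: v v_xz => v [] //= /orP[]/eqP[] // ->.
    by rewrite eq_sym (negbTE yz).
  by rewrite (negbTE xy).
- move=> _ w_xz /andP[_]; case: w w_xz => w [] //= /orP[]/eqP[] // ->.
    by rewrite (negbTE yz).
  by rewrite eq_sym (negbTE xy).
Qed.

Lemma ord3_third (x y : 'I_3) : x != y -> exists z, uniq [:: x; y; z].
Proof.
move=> xy; have /card_gt0P[z] : (0 < #|~: [set x; y]|)%N.
  by rewrite cardsCs setCK cards2 xy card_ord.
rewrite !inE negb_or => /andP[zx zy]; exists z.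
by rewrite /= !inE negb_or xy !(eq_sym _ z) zx zy.
Qed.

Theorem corollary10p6 :
  lattice_embeds L (Co Q) /\
  ~ (exists (d : Order.disp_t) (R : finPOrderType d),
       tree_like R /\ lattice_embeds L (Co R)).
Proof.
split; first by exists val; split=> //; apply: val_inj.
case=> d [R [treeR [f [f_inj fI fU]]]].
pose A x := L_atom (x, false); pose A' x := L_atom (x, true).
have meetAA' x : A x `&` A' x = L_bot.
  by apply: L_atom_meet; rewrite xpair_eqE andbF.
have meetAA x y : x != y -> A x `&` A y = L_bot.
  by move=> xy; apply: L_atom_meet; rewrite xpair_eqE andbT.
have zz := zigzag_ascends meetAA' L_atom_le_join
  L_atom_meet_join ord3_third fI fU.
pose x0 : 'I_3 := ord0; pose x1 : 'I_3 := inord 1.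
have x01 : x0 != x1 by rewrite -val_eqE /= inordK.
have [x2 x012] := ord3_third x01.
have [p [up|down]] := ascends_exists meetAA' meetAA
  L_atom_le_join fI fU f_inj x01 (L_atom_neq_bot x0 false).
  exact: tree_like_no_zigzag treeR zz x012 up.
exact: tree_like_no_zigzag (tree_like_dual treeR) (zigzag_dual zz) x012 down.
Qed.
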